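(* Let $n,m\ge 1$ be integers and let $T:\mathbb{C}^{n\times n}\to\mathbb{C}^{m\times m}$ be a linear map. If $T$ is $\min\{n,m\}$-positive, then $T$ is completely positive.
   Context: A matrix is called positive if it is positive semidefinite, and a linear map between matrix algebras is called positive if it maps positive matrices to positive matrices. For an integer $k\ge 1$, $M_k(\mathbb{C}^{n\times n})$ denotes the $k\times k$ matrices with entries in $\mathbb{C}^{n\times n}$, identified with the matrices acting on $\mathbb{C}^k\otimes\mathbb{C}^n$. The map $T_k=\mathrm{id}_k\otimes T: M_k(\mathbb{C}^{n\times n})\to M_k(\mathbb{C}^{m\times m})$ is defined by $T_k\big((a_{ij})_{i,j=1}^k\big)=(T(a_{ij}))_{i,j=1}^k$. $T$ is $k$-positive if $T_k$ is positive; $T$ is completely positive if it is $k$-positive for all integers $k\ge 1$. *)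

(* Defs.v *)
From mathcomp Require Import all_boot all_order all_algebra.
From mathcomp Require Import reals.
From mathcomp Require Export complex.

Set Implicit Arguments.
Unset Strict Implicit.
Unset Printing Implicit Defensive.

Import Order.TTheory GRing.Theory Num.Theory.
Local Open Scope ring_scope.
Local Open Scope sesquilinear_scope.

(* On R[i], [0 <= z] means that z is real and nonnegative. *)
Definition psdmx (C : numClosedFieldType) (n : nat) (A : 'M[C]_n) : Prop :=
  A \is hermsymmx /\ forall v : 'cV[C]_n, 0 <= (v ^t* *m A *m v) 0 0.

Definition positive_map (C : numClosedFieldType) (n m : nat)
    (T : 'M[C]_n -> 'M[C]_m) : Prop :=
  forall A : 'M[C]_n, psdmx A -> psdmx (T A).

(* M_k(C^{n x n}) is identified with the square matrices of size
   [\sum_(i < k) n] (= k * n); [submxblock A i j] is the entry a_ij of A, an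
   n x n matrix. *)
Definition ampliation (C : numClosedFieldType) (n m k : nat)
    (T : 'M[C]_n -> 'M[C]_m) (A : 'M[C]_(\sum_(i < k) n)) :
    'M[C]_(\sum_(i < k) m) :=
  \mxblock_(i < k, j < k)
    T (@submxblock C k k (fun=> n) (fun=> n) A i j).

Lemma ampliation_mxblock (C : numClosedFieldType) (n m k : nat)
    (T : 'M[C]_n -> 'M[C]_m) (a : 'I_k -> 'I_k -> 'M[C]_n) :
  ampliation T (\mxblock_(i < k, j < k) a i j)
    = \mxblock_(i < k, j < k) T (a i j).
Proof. by apply: eq_mxblock => i j; rewrite mxblockK. Qed.

Lemma ampliation_is_linear (C : numClosedFieldType) (n m k : nat)
    (T : {linear 'M[C]_n -> 'M[C]_m}) : linear (@ampliation C n m k T).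
Proof.
move=> c A B; apply/matrixP => p q; rewrite !mxE.
have -> : forall i j, @submxblock C k k (fun=> n) (fun=> n) (c *: A + B) i j
    = c *: submxblock A i j + submxblock B i j.
  by move=> i j; apply/matrixP => x y; rewrite !mxE.
by rewrite linearP !mxE.
Qed.

Definition k_positive (C : numClosedFieldType) (n m k : nat)
    (T : 'M[C]_n -> 'M[C]_m) : Prop :=
  positive_map (@ampliation C n m k T).

Definition completely_positive (C : numClosedFieldType) (n m : nat)
    (T : 'M[C]_n -> 'M[C]_m) : Prop :=
  forall k : nat, (1 <= k)%N -> k_positive k T.

(* Main.v *)
(* A positive matrix is a sum of rank-one matrices x x^H (writing x^H for the
   conjugate transpose), so k-positivity of T says exactly that
   sum_(i,j < k) v_i^H T (w_i w_j^H) v_j >= 0 for all vectors w_i in C^n and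
   v_i in C^m. This form is sesquilinear: linear combinations taken in the
   family w can be moved to the family v and back. Expanding the w_i in a basis
   of C^n leaves n^2 summands, and expanding the v_i in a basis of C^m leaves
   m^2 summands, which are the cases k = n and k = m. *)
Require Import Defs.
From mathcomp Require Import all_boot all_order all_algebra.
From mathcomp Require Import reals.
From mathcomp Require Import ring.
Set Implicit Arguments.
Unset Strict Implicit.
Unset Printing Implicit Defensive.
Local Open Scope ring_scope.

Import Order.TTheory GRing.Theory Num.Theory.
Local Open Scope sesquilinear_scope.

Lemma trmxC_mul (C : numClosedFieldType) m n p (A : 'M[C]_(m, n))
    (B : 'M[C]_(n, p)) : (A *m B)^t* = B^t* *m A^t*.
Proof. by rewrite trmx_mul map_mxM. Qed.

Lemma trmxC_lincomb (C : numClosedFieldType) (I : finType) m n (c : I -> C)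
    (X : I -> 'M[C]_(m, n)) :
  (\sum_i c i *: X i)^t* = \sum_i (c i)^* *: (X i)^t*.
Proof.
rewrite raddf_sum /= map_mx_sum; apply: eq_bigr => i _.
by rewrite linearZ /= map_mxZ.
Qed.

(** Over a complex field hermitian symmetry comes for free by polarization: real values of the form
    at [x + y] and [x + 'i *: y] determine [b x y] as the conjugate of [b y x]. *)
Lemma psdmx_ge0 (C : numClosedFieldType) n (A : 'M[C]_n) :
  (forall v : 'cV[C]_n, 0 <= (v^t* *m A *m v) 0 0) -> psdmx A.
Proof.
move=> A_ge0; split=> //; apply/is_hermitianmxP; rewrite expr0 scale1r.
pose b (x y : 'cV[C]_n) := (x^t* *m A *m y) 0 0.
have bE i j : b (delta_mx i 0) (delta_mx j 0) = A i j.
  by rewrite /b trmx_delta map_delta_mx -rowE -colE !mxE.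
have b_real v : (b v v)^* = b v v by apply/CrealP/ger0_real/A_ge0.
have expand c (x y : 'cV[C]_n) : b (x + c *: y) (x + c *: y)
    = b x x + b y y * (c * c^*) + (c * b x y + c^* * b y x).
  have trC : (x + c *: y)^t* = x^t* + c^* *: y^t*.
    by apply/matrixP => i j; rewrite !mxE rmorphD rmorphM.
  rewrite /b trC !mulmxDl !mulmxDr.
  rewrite -!scalemxAl -!scalemxAr !mxE; ring.
(* The cross terms are a combination of real values of the form, hence real. *)
have cross c x y :
    (c * b x y + c^* * b y x)^* = c * b x y + c^* * b y x.
  have -> : c * b x y + c^* * b y x
      = b (x + c *: y) (x + c *: y) - b x x - b y y * (c * c^*).
    by rewrite expand; ring.
  by rewrite !rmorphB /= !rmorphM /= conjCK !b_real (mulrC c^*).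
apply/matrixP => i j; rewrite !mxE -!bE.
set x := delta_mx i 0; set y := delta_mx j 0.
have := cross 1 x y; have := cross 'i x y.
rewrite !rmorphD !rmorphM /= conjCi !rmorphN /= conjCi !conjC1 !mul1r => e1 e2.
have i2_neq0 : 2 * 'i != 0 :> C by rewrite mulf_neq0 ?pnatr_eq0 ?neq0Ci.
apply: (mulfI i2_neq0).
(* Adding ['i] times the case [c = 1] to the case [c = 'i] cancels the conjugate of [b x y]. *)
have -> : 2 * 'i * (b y x)^* = - ('i * (b x y)^* ) + 'i * (b y x)^*
    + 'i * ((b x y)^* + (b y x)^* ) by ring.
rewrite e2 -mulNr -[X in _ + X * _ + _]opprK e1; ring.
Qed.

(** Spectral theorem: [A = P^t* *m diag_mx d *m P] with [P] unitary, and [X] is [P^t*] times the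
    square root of the diagonal. *)
Lemma psdmx_factor (C : numClosedFieldType) n (A : 'M[C]_n) :
  psdmx A -> exists X : 'M[C]_n, A = X *m X^t*.
Proof.
move=> [Aherm A_ge0].
have /hermitian_normalmx/orthomx_spectralP := Aherm.
set P := spectralmx A; set d := spectral_diag A => AE.
have Punit : P \is unitarymx by apply: spectral_unitarymx.
rewrite invmx_unitary // in AE.
have PK : P *m P^t* = 1%:M by apply/unitarymxP.
have d_ge0 i : 0 <= d 0 i.
  (* Testing [A] on its i-th eigenvector returns the eigenvalue [d 0 i]. *)
  have := A_ge0 (P^t* *m delta_mx i 0).
  rewrite {1}AE trmxC_mul trmxCK !mulmxA -(mulmxA _ P) PK mulmx1.
  rewrite -(mulmxA _ P) PK mulmx1 trmx_delta map_delta_mx -rowE -colE !mxE.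
  by rewrite eqxx mulr1n.
exists (P^t* *m diag_mx (map_mx sqrtC d)).
rewrite trmxC_mul trmxCK tr_diag_mx map_diag_mx !mulmxA -(mulmxA (P^t* )).
rewrite mulmx_diag {1}AE; congr (_ *m diag_mx _ *m _).
apply/rowP => i; rewrite !mxE /= geC0_conj ?sqrtC_ge0 // -expr2.
by rewrite sqrtCK.
Qed.

(** When [w] is the standard basis of C^n, this is the quadratic form of the Choi matrix of [T] at
    the stacked vector [v]. *)
Definition choi_form (C : numClosedFieldType) n m (T : 'M[C]_n -> 'M[C]_m) k
    (w : 'I_k -> 'cV[C]_n) (v : 'I_k -> 'cV[C]_m) : C :=
  \sum_i \sum_j ((v i)^t* *m T (w i *m (w j)^t* ) *m v j) 0 0.

Lemma mxcol_trmxC (C : numClosedFieldType) n k (x : 'I_k -> 'cV[C]_n) :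
  (\mxcol_i x i)^t* = \mxrow_i (x i)^t*.
Proof. by apply/matrixP => i j; rewrite !mxE. Qed.

Lemma ampliation_rank1 (C : numClosedFieldType) n m (T : 'M[C]_n -> 'M[C]_m) k
    (w : 'I_k -> 'cV[C]_n) (v : 'I_k -> 'cV[C]_m) :
  ((\mxcol_i v i)^t* *m ampliation T ((\mxcol_i w i) *m (\mxcol_i w i)^t* )
     *m \mxcol_i v i) 0 0 = choi_form T w v.
Proof.
rewrite !mxcol_trmxC mul_mxcol_mxrow ampliation_mxblock -mulmxA.
rewrite mul_mxblock_mxrow mul_mxrow_mxcol summxE; apply: eq_bigr => i _.
by rewrite mulmx_sumr summxE; apply: eq_bigr => j _; rewrite mulmxA.
Qed.

Lemma mulmx_trmxC_sum_col (C : numClosedFieldType) m n (X : 'M[C]_(m, n)) :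
  X *m X^t* = \sum_r col r X *m (col r X)^t*.
Proof.
apply/matrixP => i j; rewrite summxE !mxE; apply: eq_bigr => r _.
by rewrite !mxE big_ord1 !mxE.
Qed.

(** Rank-one matrices suffice: [X *m X^t*] is the sum of the rank-one matrices of its columns, and
    [ampliation] is additive. *)
Lemma k_positiveP (C : numClosedFieldType) n m k
    (T : {linear 'M[C]_n -> 'M[C]_m}) :
  k_positive k T <->
  forall (w : 'I_k -> 'cV[C]_n) (v : 'I_k -> 'cV[C]_m), 0 <= choi_form T w v.
Proof.
split=> [Tpos w v | form_ge0 A /psdmx_factor [X ->]].
  rewrite -ampliation_rank1; apply: (Tpos _ _).2; apply: psdmx_ge0 => u.
  set x := \mxcol_i _; rewrite mulmxA -mulmxA.
  (* The form of [x *m x^t*] at [u] is the squared modulus of [x^t* *m u]. *)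
  have -> : u^t* *m x = (x^t* *m u)^t* by rewrite trmxC_mul trmxCK.
  by rewrite mxE big_ord1 !mxE mulrC mul_conjC_ge0.
apply: psdmx_ge0 => v; pose L := @ampliation_is_linear C n m k T.
have ampD : {morph (@ampliation C n m k T) : A B / A + B}.
  by move=> B D; have := L 1 B D; rewrite !scale1r.
have amp0 : ampliation T (0 : 'M_(\sum_(i < k) n)) = 0.
  by apply: (addrI (ampliation T 0)); rewrite -ampD !addr0.
rewrite mulmx_trmxC_sum_col (big_morph _ ampD amp0).
rewrite mulmx_sumr mulmx_suml summxE; apply: sumr_ge0 => r _.
by rewrite -[col r X]submxcolK -[v]submxcolK ampliation_rank1.
Qed.

(** Both sides expand to the same fourfold sum; the coefficients get conjugated because [v i] enters
    through its adjoint. The length of the families changes from [k] to [d]. *)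
Lemma choi_form_lincomb (C : numClosedFieldType) n m
    (T : {linear 'M[C]_n -> 'M[C]_m}) k d (W : 'I_d -> 'I_k -> C)
    (w : 'I_d -> 'cV[C]_n) (v : 'I_k -> 'cV[C]_m) :
  choi_form T (fun i => \sum_a W a i *: w a) v
    = choi_form T w (fun a => \sum_i (W a i)^* *: v i).
Proof.
pose F a b i j := W a i * (W b j)^* *
  ((v i)^t* *m T (w a *m (w b)^t* ) *m v j) 0 0.
transitivity (\sum_i \sum_j \sum_a \sum_b F a b i j).
  apply: eq_bigr => i _; apply: eq_bigr => j _.
  rewrite trmxC_lincomb mulmx_suml linear_sum mulmx_sumr mulmx_suml summxE.
  apply: eq_bigr => a _.
  rewrite mulmx_sumr linear_sum mulmx_sumr mulmx_suml summxE.
  apply: eq_bigr => b _.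
  by rewrite -scalemxAl -scalemxAr scalerA linearZ -scalemxAr -scalemxAl mxE.
transitivity (\sum_a \sum_b \sum_i \sum_j F a b i j).
  under eq_bigr => i _ do rewrite exchange_big.
  rewrite exchange_big; apply: eq_bigr => a _.
  under eq_bigr => i _ do rewrite exchange_big.
  by rewrite exchange_big.
apply: eq_bigr => a _; apply: eq_bigr => b _.
rewrite trmxC_lincomb !mulmx_suml summxE; apply: eq_bigr => i _.
rewrite mulmx_sumr summxE; apply: eq_bigr => j _.
by rewrite conjCK -!scalemxAl -scalemxAr scalerA mxE.
Qed.

Lemma colE_lincomb (C : numClosedFieldType) n (x : 'cV[C]_n) :
  x = \sum_a x a 0 *: delta_mx a 0.
Proof. by rewrite [LHS]matrix_sum_delta; under eq_bigr do rewrite big_ord1. Qed.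

Lemma eq_choi_form (C : numClosedFieldType) n m (T : 'M[C]_n -> 'M[C]_m) k
    (w w' : 'I_k -> 'cV[C]_n) (v v' : 'I_k -> 'cV[C]_m) :
  w =1 w' -> v =1 v' -> choi_form T w v = choi_form T w' v'.
Proof.
move=> ww vv; apply: eq_bigr => i _; apply: eq_bigr => j _.
by rewrite !ww !vv.
Qed.

Lemma k_positive_dom (C : numClosedFieldType) n m
    (T : {linear 'M[C]_n -> 'M[C]_m}) :
  k_positive n T -> completely_positive T.
Proof.
move=> /k_positiveP T_ge0 k _; apply/k_positiveP => w v.
(* Expanding [w] in the standard basis of C^n turns length [k] into length [n]. *)
rewrite (eq_choi_form _ (fun i => colE_lincomb (w i)) (fun=> erefl)).
by rewrite (choi_form_lincomb _ (fun a i => w i a 0)).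
Qed.

Lemma k_positive_codom (C : numClosedFieldType) n m
    (T : {linear 'M[C]_n -> 'M[C]_m}) :
  k_positive m T -> completely_positive T.
Proof.
move=> /k_positiveP T_ge0 k _; apply/k_positiveP => w v.
(* The double conjugate matches the right-hand side of [choi_form_lincomb], which is then read
   backwards to reach length [m]. *)
have vE i : v i = \sum_a ((v i a 0)^*)^* *: delta_mx a 0.
  by under eq_bigr do rewrite conjCK; apply: colE_lincomb.
rewrite (eq_choi_form _ (fun=> erefl) vE).
by rewrite -(choi_form_lincomb _ (fun i a => (v i a 0)^*)).
Qed.

Theorem corollary1 (R : realType) (n m : nat) (hn : (1 <= n)%N) (hm : (1 <= m)%N)
    (T : {linear 'M[R[i]]_n -> 'M[R[i]]_m}) :
  k_positive (minn n m) T -> completely_positive T.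
Proof.
by case: (leqP n m) => _; [apply: k_positive_dom | apply: k_positive_codom].
Qed.
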